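(* Let $k$ be an algebraically closed field, $Q$ a quiver, $\Sigma\subset\mathrm{Aut}^+(Q)$ a subgroup, and $d,\theta$ $\Sigma$-compatible. Let $m=\mathbf{G}_{Q,d}\cdot M\in\mathcal{M}^{\theta\text{-}s}_{Q,d}(k)$. If non-empty, the fibre $(f^{rs}_\Sigma)^{-1}(m)$ is in bijection with the pointed set $$\ker\big(H^1(\Sigma,\Delta(k))\to H^1(\Sigma,\mathbf{G}_{Q,d}(k))\big).$$
   Context: A quiver $Q=(V,A,h,t)$ has finite vertex set $V$, finite arrow set $A$, head and tail maps $h,t:A\to V$. For $d\in\mathbb{N}^V$, $\mathrm{Rep}_{Q,d}=\prod_{a\in A}\mathrm{Mat}_{d_{h(a)}\times d_{t(a)}}$ with the action of $\mathbf{G}_{Q,d}=\prod_v\mathbf{GL}_{d_v}$ given by $g\cdot M=(g_{h(a)}M_ag_{t(a)}^{-1})_a$; $\Delta=\{(tI_{d_v})_v:t\in\mathbb{G}_m\}$. For $\theta\in\mathbb{Z}^V$, a nonzero representation $W$ is $\theta$-stable if $\mu_\theta(W')<\mu_\theta(W)$ for all subrepresentations $0\ne W'\subsetneq W$, where $\mu_\theta(W)=\sum_v\theta_v\dim W_v/\sum_v\dim W_v$. Let $\mathrm{Rep}_{Q,d}^{\chi_\theta\text{-}s}$ be the open locus of $\theta$-stable points; by King it is the GIT stable locus for the character $\chi_\theta(g)=\prod_v(\det g_v)^{-\theta'_v}$, $\theta'_v=\theta_v\sum_\alpha d_\alpha-\sum_\alpha\theta_\alpha d_\alpha$. $\mathcal{M}^{\theta\text{-}s}_{Q,d}=\mathrm{Rep}_{Q,d}^{\chi_\theta\text{-}s}/\mathbf{G}_{Q,d}$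 is the geometric quotient. The stabiliser of a stable point is $\Delta(k)$. $\mathrm{Aut}^+(Q)$ is the group of pairs of bijections $\sigma:V\to V$, $\sigma:A\to A$ with $t\sigma=\sigma t$, $h\sigma=\sigma h$. $d,\theta$ are $\Sigma$-compatible if $d_{\sigma(v)}=d_v$, $\theta_{\sigma(v)}=\theta_v$ for all $\sigma\in\Sigma$, $v\in V$. $\Sigma$ acts on $\mathrm{Rep}_{Q,d}$ by $\sigma(M)=(M_{\sigma(a)})_a$ and on $\mathbf{G}_{Q,d}$ by $\sigma(g)=(g_{\sigma(v)})_v$ (product in $\Sigma$ written so that these are left actions), trivially on $\Delta$. $(\mathrm{Rep}_{Q,d}^\Sigma)^{\chi_\theta\text{-}rs}=\mathrm{Rep}_{Q,d}^\Sigma\cap\mathrm{Rep}_{Q,d}^{\chi_\theta\text{-}s}$, $\mathcal{M}^{(\Sigma,\theta)\text{-}rs}_{Q,d}=(\mathrm{Rep}_{Q,d}^\Sigma)^{\chi_\theta\text{-}rs}/\mathbf{G}_{Q,d}^\Sigma$ (a geometric quotient), and $f^{rs}_\Sigma:\mathcal{M}^{(\Sigma,\theta)\text{-}rs}_{Q,d}\to(\mathcal{M}^{\theta\text{-}s}_{Q,d})^\Sigma$ is the morphism induced by the inclusion. By a point (and by the fibre) one means closed points. $H^1(\Sigma,\mathbf{G}_{Q,d}(k))$ is the non-abelian cohomology pointed set: 1-cocycles $b:\Sigma\to\mathbf{G}_{Q,d}(k)$, $b(\sigma_1\sigma_2)=b(\sigma_1)\sigma_1(b(\sigma_2))$, modulo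 $b\sim b'$ iff $b'(\sigma)=gb(\sigma)\sigma(g)^{-1}$ for some $g$. The kernel is the preimage of the base point under the map induced by $\Delta\subset\mathbf{G}_{Q,d}$. *)

(* Defs.v *)
From HB Require Import structures.
From mathcomp Require Import all_boot all_order all_algebra all_fingroup.
From mathcomp Require Import boolp classical_sets functions.

Set Implicit Arguments.
Unset Strict Implicit.
Unset Printing Implicit Defensive.

Import Order.TTheory GRing.Theory Num.Theory.
Local Open Scope classical_set_scope.
Local Open Scope ring_scope.

Record quiver := Quiver {
  vertex : finType;
  arrow : finType;
  qhead : arrow -> vertex;
  qtail : arrow -> vertex }.

(* The product of permutations in MathComp is [(s * u) x = u (s x)]; this is
   the convention that makes [rep_act] and [gl_act] below left actions. *)
Notation quiver_perm Q := ({perm vertex Q} * {perm arrow Q})%type.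

Definition AutQ (Q : quiver) : {set quiver_perm Q} :=
  [set s : quiver_perm Q | [forall a, (qtail (s.2 a) == s.1 (qtail a))
                   && (qhead (s.2 a) == s.1 (qhead a))]]%SET.

Definition compatible (Q : quiver) (S : {group quiver_perm Q}) (T : Type)
    (f : vertex Q -> T) : Prop :=
  forall s, s \in S -> forall v, f (s.1 v) = f v.

Definition rep (k : fieldType) (Q : quiver) (d : vertex Q -> nat) :=
  {dffun forall a : arrow Q, 'M[k]_(d (qhead a), d (qtail a))}.

Record GL (k : fieldType) (V : finType) (d : V -> nat) := MkGL {
  GLfun :> {dffun forall v : V, 'M[k]_(d v)};
  GLfun_unit : [forall v, GLfun v \in unitmx] }.

HB.instance Definition _ (k : fieldType) (V : finType) (d : V -> nat) :=
  [isSub for @GLfun k V d].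
HB.instance Definition _ (k : fieldType) (V : finType) (d : V -> nat) :=
  [Choice of GL k d by <:].

Section GLGroup.
Context (k : fieldType) (V : finType) (d : V -> nat).
Implicit Types g h : GL k d.

Lemma GLP g h : (forall v, g v = h v) -> g = h.
Proof. by move=> e; apply/val_inj/ffunP. Qed.

Lemma GL_unitmx g v : g v \in unitmx.
Proof. by have /forallP := GLfun_unit g. Qed.

Fact gl_one_subproof :
  [forall v, [ffun v => 1%:M : 'M[k]_(d v)] v \in unitmx].
Proof. by apply/forallP => v; rewrite ffunE unitmx1. Qed.
Definition gl_one := MkGL gl_one_subproof.

Fact gl_mul_subproof g h :
  [forall v, [ffun v => g v *m h v : 'M[k]_(d v)] v \in unitmx].
Proof. by apply/forallP => v; rewrite ffunE unitmx_mul !GL_unitmx. Qed.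
Definition gl_mul g h := MkGL (gl_mul_subproof g h).

Fact gl_inv_subproof g :
  [forall v, [ffun v => invmx (g v) : 'M[k]_(d v)] v \in unitmx].
Proof. by apply/forallP => v; rewrite ffunE unitmx_inv GL_unitmx. Qed.
Definition gl_inv g := MkGL (gl_inv_subproof g).

Fact gl_mulA : associative gl_mul.
Proof. by move=> x y z; apply: GLP => v; rewrite !ffunE mulmxA. Qed.
Fact gl_mul1g : left_id gl_one gl_mul.
Proof. by move=> x; apply: GLP => v; rewrite !ffunE mul1mx. Qed.
Fact gl_mulg1 : right_id gl_one gl_mul.
Proof. by move=> x; apply: GLP => v; rewrite !ffunE mulmx1. Qed.
Fact gl_mulVg : left_inverse gl_one gl_inv gl_mul.
Proof. by move=> x; apply: GLP => v; rewrite !ffunE mulVmx ?GL_unitmx. Qed.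
Fact gl_mulgV : right_inverse gl_one gl_inv gl_mul.
Proof. by move=> x; apply: GLP => v; rewrite !ffunE mulmxV ?GL_unitmx. Qed.

HB.instance Definition _ :=
  isGroup.Build (GL k d) gl_mulA gl_mul1g gl_mulg1 gl_mulVg gl_mulgV.

End GLGroup.

Definition Delta (k : fieldType) (V : finType) (d : V -> nat) : set (GL k d) :=
  [set g | exists2 t : k, t != 0 & forall v, g v = t%:M].
Arguments Delta k {V} d.

Definition gl_rep (k : fieldType) (Q : quiver) (d : vertex Q -> nat)
    (g : GL k d) (M : rep k d) : rep k d :=
  [ffun a => g (qhead a) *m M a *m invmx (g (qtail a))].

(* [M (s.2 a)] and [M a] have the same size only propositionally, when [s] is an
   automorphism leaving [d] invariant; [conform_mx] is then the transport along
   these equalities, and its default value is irrelevant. *)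
Definition rep_act (k : fieldType) (Q : quiver) (d : vertex Q -> nat)
    (s : quiver_perm Q) (M : rep k d) : rep k d :=
  [ffun a => conform_mx (M a) (M (s.2 a))].

Fact gl_act_subproof (k : fieldType) (Q : quiver) (d : vertex Q -> nat)
    (s : quiver_perm Q) (g : GL k d) :
  [forall v, [ffun v => conform_mx (g v) (g (s.1 v)) : 'M[k]_(d v)] v
               \in unitmx].
Proof.
apply/forallP => v; rewrite ffunE.
have := GL_unitmx g (s.1 v); move: (g (s.1 v)) => B.
case: (eqVneq (d (s.1 v)) (d v)) B => [e|ne] B.
  by case: _ / e (g v) => C; rewrite conform_mx_id.
by rewrite nonconform_mx ?ne // GL_unitmx.
Qed.
Definition gl_act (k : fieldType) (Q : quiver) (d : vertex Q -> nat)
    (s : quiver_perm Q) (g : GL k d) : GL k d := MkGL (gl_act_subproof s g).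

Definition rep_fixed (k : fieldType) (Q : quiver) (d : vertex Q -> nat)
    (S : {group quiver_perm Q}) : set (rep k d) :=
  [set M | forall s, s \in S -> rep_act s M = M].

Definition gl_fixed (k : fieldType) (Q : quiver) (d : vertex Q -> nat)
    (S : {group quiver_perm Q}) : set (GL k d) :=
  [set g | forall s, s \in S -> gl_act s g = g].

Definition slope (V : finType) (theta : V -> int) (e : V -> nat) : rat :=
  (\sum_v theta v * (e v)%:Z)%:~R / (\sum_v e v)%:R.

Definition subrep (k : fieldType) (Q : quiver) (d : vertex Q -> nat)
    (M : rep k d) (W : forall v, {vspace 'cV[k]_(d v)}) : Prop :=
  forall a x, x \in W (qtail a) -> M a *m x \in W (qhead a).

Definition stable (k : fieldType) (Q : quiver) (d : vertex Q -> nat)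
    (theta : vertex Q -> int) : set (rep k d) :=
  [set M | (exists v, d v != 0%N) /\
    forall W : (forall v, {vspace 'cV[k]_(d v)}), subrep M W ->
      (exists v, W v != 0%VS) -> (exists v, W v != fullv) ->
      slope theta (fun v => \dim (W v)) < slope theta d].

(* Over an algebraically closed field the closed points of a geometric quotient
   [X / G] are the [G]-orbits of closed points of [X]; points of the moduli
   spaces are represented by these orbits. *)
Definition gl_orbit (k : fieldType) (Q : quiver) (d : vertex Q -> nat)
    (H : set (GL k d)) (M : rep k d) : set (rep k d) :=
  [set gl_rep g M | g in H].

Definition moduli_s (k : fieldType) (Q : quiver) (d : vertex Q -> nat)
    (theta : vertex Q -> int) : set (set (rep k d)) :=
  [set gl_orbit setT M | M in stable theta].

Definition moduli_s_fixed (k : fieldType) (Q : quiver) (d : vertex Q -> nat)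
    (S : {group quiver_perm Q}) (theta : vertex Q -> int) :
    set (set (rep k d)) :=
  [set m | moduli_s theta m /\ forall s, s \in S -> rep_act s @` m = m].

Definition moduli_rs (k : fieldType) (Q : quiver) (d : vertex Q -> nat)
    (S : {group quiver_perm Q}) (theta : vertex Q -> int) :
    set (set (rep k d)) :=
  [set gl_orbit (gl_fixed S) M | M in rep_fixed S `&` stable theta].

Definition f_rs (k : fieldType) (Q : quiver) (d : vertex Q -> nat)
    (O : set (rep k d)) : set (rep k d) :=
  \bigcup_(M in O) gl_orbit setT M.

Section QuiverFacts.
Context (k : fieldType) (Q : quiver) (d : vertex Q -> nat).
Context (S : {group quiver_perm Q}).
Context (S_Aut : S \subset AutQ Q) (d_compat : compatible S d).
Implicit Types (s : quiver_perm Q) (g h : GL k d) (M : rep k d).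

Lemma gl_rep1 M : gl_rep (1 : GL k d)%g M = M.
Proof.
apply/ffunP => a; rewrite !ffunE.
have -> : invmx 1%:M = 1%:M :> 'M[k]_(d (qtail a)) by rewrite invmx1.
by rewrite mul1mx mulmx1.
Qed.

Lemma gl_repM g h M : gl_rep (g * h)%g M = gl_rep g (gl_rep h M).
Proof.
apply/ffunP => a; rewrite !ffunE.
have E (x : GL k d) v : invmx (x v) = (x^-1)%g v by rewrite ffunE.
have := E (g * h)%g (qtail a); rewrite ffunE invMg ffunE -!E => ->.
by rewrite !mulmxA.
Qed.

Lemma AutQ_qtail s a : s \in S -> qtail (s.2 a) = s.1 (qtail a).
Proof.
by move/(fintype.subsetP S_Aut); rewrite inE => /forallP/(_ a)/andP[/eqP].
Qed.

Lemma AutQ_qhead s a : s \in S -> qhead (s.2 a) = s.1 (qhead a).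
Proof.
by move/(fintype.subsetP S_Aut); rewrite inE => /forallP/(_ a)/andP[_ /eqP].
Qed.

Lemma rep_act_gl s g M : s \in S ->
  rep_act s (gl_rep g M) = gl_rep (gl_act s g) (rep_act s M).
Proof.
move=> sS; apply/ffunP => a; rewrite !ffunE.
have et := AutQ_qtail a sS; have eh := AutQ_qhead a sS.
have dt := d_compat sS (qtail a); have dh := d_compat sS (qhead a).
move: (M a) (M (s.2 a)) (g (qhead a)) (g (qtail a)) => A B C D.
move: B; rewrite et eh.
move: (g (s.1 _)) (g (s.1 _)) => E F B.
move: A B C D E F; rewrite dt dh => A B C D E F.
by rewrite !conform_mx_id.
Qed.

Lemma gl_act_mul s g h : s \in S ->
  gl_act s (g * h)%g = (gl_act s g * gl_act s h)%g.
Proof.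
move=> sS; apply: GLP => v; rewrite !ffunE.
have dv := d_compat sS v.
move: (g v) (h v) (g (s.1 v)) (h (s.1 v)); rewrite dv => A B C D.
by rewrite !conform_mx_id.
Qed.

Lemma dim_qhead s a : s \in S -> d (qhead (s.2 a)) = d (qhead a).
Proof. by move=> sS; rewrite AutQ_qhead ?d_compat. Qed.
Lemma dim_qtail s a : s \in S -> d (qtail (s.2 a)) = d (qtail a).
Proof. by move=> sS; rewrite AutQ_qtail ?d_compat. Qed.

Lemma conform_mx_trans m n m1 n1 m2 n2 (A A' : 'M[k]_(m, n)) (B : 'M_(m1, n1))
  (C : 'M_(m2, n2)) : m1 = m -> n1 = n -> m2 = m -> n2 = n ->
  conform_mx A C = conform_mx A' (conform_mx B C).
Proof.
by move=> *; subst; rewrite !conform_mx_id.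
Qed.

Lemma rep_act_comp s s' M : s \in S -> s' \in S ->
  rep_act (s * s')%g M = rep_act s (rep_act s' M).
Proof.
move=> sS s'S; apply/ffunP => a; rewrite !ffunE /= permM.
by apply: conform_mx_trans; rewrite ?dim_qhead ?dim_qtail // ?dim_qhead ?dim_qtail.
Qed.

Lemma gl_act_comp s s' g : s \in S -> s' \in S ->
  gl_act (s * s')%g g = gl_act s (gl_act s' g).
Proof.
move=> sS s'S; apply/GLP => a; rewrite !ffunE /= permM.
by apply: conform_mx_trans; rewrite !d_compat.
Qed.

Lemma rep_actE s M a (i : 'I_(d (qhead a))) (j : 'I_(d (qtail a)))
  (i' : 'I_(d (qhead (s.2 a)))) (j' : 'I_(d (qtail (s.2 a)))) :
  s \in S -> i' = i :> nat -> j' = j :> nat -> rep_act s M a i j = M (s.2 a) i' j'.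
Proof.
move=> sS; rewrite ffunE; move: (M a) (M (s.2 a)) i j i' j'.
rewrite dim_qhead // dim_qtail // => A B i j i' j' ii jj.
by rewrite conform_mx_id; congr (B _ _); apply/val_inj.
Qed.

Lemma f_rs_orbit (D : set (GL k d)) M : D 1%g ->
  f_rs (gl_orbit D M) = gl_orbit setT M.
Proof.
move=> D1; apply/seteqP; split=> N.
  by move=> [_ [g _ <-]] [h _ <-]; exists (h * g)%g; rewrite // gl_repM.
by move=> [g _ <-]; exists M; [exists 1%g; rewrite ?gl_rep1 | exists g].
Qed.

Lemma f_rs_fun theta :
  set_fun (moduli_rs S theta) (moduli_s_fixed S theta) (@f_rs k Q d).
Proof.
move=> _ [M [MS Mst] <-]; rewrite f_rs_orbit; last first.
  by move=> s sS; apply: GLP => v; rewrite !ffunE;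
    have := d_compat sS v => /esym e; case: _ / e; rewrite conform_mx_id.
have sub s : s \in S -> rep_act s @` gl_orbit setT M `<=` gl_orbit setT M.
  move=> sS _ [_ [g _ <-] <-]; rewrite rep_act_gl // MS //.
  by exists (gl_act s g).
split; first by exists M.
move=> s sS; apply/seteqP; split; first exact: sub.
move=> _ [g _ <-]; exists (gl_rep (gl_act s^-1%g g) M).
  by exists (gl_act s^-1%g g).
have sV : s^-1%g \in S by rewrite groupV.
rewrite rep_act_gl // MS // -gl_act_comp // mulgV.
congr gl_rep; apply: GLP => v; rewrite ffunE /= perm1; exact: conform_mx_id.
Qed.
End QuiverFacts.

Definition f_rs_fibre (k : fieldType) (Q : quiver) (d : vertex Q -> nat)
    (S : {group quiver_perm Q}) (theta : vertex Q -> int)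
    (m : set (rep k d)) : set (set (rep k d)) :=
  [set O | moduli_rs S theta O /\ f_rs O = m].

(* [act] is meant to be an action of [S] on [G] by group automorphisms, and [D],
   [E] to be [S]-stable subgroups of [G]. *)
Section NonabelianH1.
Context (S : finGroupType) (G : groupType) (act : S -> G -> G).

Definition cocycle (D : set G) : set (S -> G) :=
  [set b | (forall s, D (b s)) /\
    forall s1 s2, b (s1 * s2)%g = (b s1 * act s1 (b s2))%g].

Definition cohomologous (D : set G) (b b' : S -> G) : Prop :=
  exists2 g, D g & forall s, b' s = (g * b s * (act s g)^-1)%g.

Definition H1_class (D : set G) (b : S -> G) : set (S -> G) :=
  [set b' | cocycle D b' /\ cohomologous D b b'].

Definition H1 (D : set G) : set (set (S -> G)) :=
  [set H1_class D b | b in cocycle D].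

Definition H1_base (D : set G) : set (S -> G) := H1_class D (fun=> 1%g).

(* the map [H1 D -> H1 E] induced by an inclusion of [D] in [E] *)
Definition H1_map (E : set G) (c : set (S -> G)) : set (S -> G) :=
  \bigcup_(b in c) H1_class E b.

Definition H1_ker (D E : set G) : set (set (S -> G)) :=
  [set c | H1 D c /\ H1_map E c = H1_base E].

End NonabelianH1.

Definition ker_H1_Delta (k : fieldType) (Q : quiver) (d : vertex Q -> nat)
    (S : {group quiver_perm Q}) : set (set (subg_of S -> GL k d)) :=
  H1_ker (fun s : subg_of S => @gl_act k Q d (sgval s)) (Delta k d) setT.
Arguments ker_H1_Delta k {Q} d S.

(* Main.v *)
(* A stable representation has only scalar automorphisms (Schur's lemma): for
   an eigenvalue [t] of an automorphism [g], the kernel and the image of [g - t]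
   are subrepresentations whose dimension vectors add up to [d], so unless
   [g = t] both would have a slope smaller than their weighted mean.  Now fix an
   [S]-invariant stable [M0] in the orbit.  If [g M0] is [S]-invariant too, then
   [s |-> g^-1 s(g)] takes values in the stabiliser of [M0], which is [Delta];
   the class of this cocycle depends only on the [G^S]-orbit of [g M0], dies in
   [H^1(S, G)], and every class of [Delta] that dies there arises in this way. *)
Require Import Defs.
From mathcomp Require Import all_boot all_order all_algebra all_fingroup.
From mathcomp Require Import boolp classical_sets functions.
Local Open Scope classical_set_scope.
Local Open Scope ring_scope.

Set Implicit Arguments.
Unset Strict Implicit.
Unset Printing Implicit Defensive.

Import Order.TTheory GRing.Theory Num.Theory.

(** * Slopes of complementary dimension vectors *)

Section Slope.
Context (V : finType) (theta : V -> int).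

(** The slope of [d] is the mean of the slopes of [e] and [f] weighted by total dimension. Clearing
    denominators and adding the two inequalities gives a strict inequality between equal numbers. *)
Lemma slope_seesaw (d e f : V -> nat) :
    (forall v, e v + f v = d v)%N -> (exists v, e v != 0%N) ->
    (exists v, f v != 0%N) ->
  slope theta e < slope theta d -> slope theta f < slope theta d -> False.
Proof.
have sum_gt0 (x : V -> nat) : (exists v, x v != 0%N) ->
    0 < (\sum_v x v)%:R :> rat.
  by case=> v xv; rewrite ltr0n (bigD1 v) //= addn_gt0 lt0n xv.
move=> efd e0 f0.
have dimD : (\sum_v d v)%:R = (\sum_v e v)%:R + (\sum_v f v)%:R :> rat.
  by rewrite -natrD -big_split; congr _%:R; apply: eq_bigr => v _; rewrite /= efd.
have degD : (\sum_v theta v * (d v)%:Z)%:~R =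
    (\sum_v theta v * (e v)%:Z)%:~R + (\sum_v theta v * (f v)%:Z)%:~R :> rat.
  rewrite -rmorphD -big_split; congr _%:~R; apply: eq_bigr => v _.
  by rewrite /= -efd PoszD mulrDr.
have ep := sum_gt0 _ e0; have fp := sum_gt0 _ f0.
rewrite /slope dimD degD !ltr_pdivrMr // ![_ / _ * _]mulrAC.
rewrite !(ltr_pdivlMr, addr_gt0) // => lt_e lt_f.
by have := ltrD lt_e lt_f; rewrite -mulrDl -mulrDr ltxx.
Qed.

End Slope.

(** * Matrices acting on column vectors: kernels and eigenvectors *)

Section ColumnVectors.
Context (k : fieldType) (n : nat).

Lemma dim_colv : \dim (fullv : {vspace 'cV[k]_n}) = n.
Proof. by rewrite dimvf /dim /= muln1. Qed.

Lemma linfun_mulmxE (A : 'M[k]_n) (x : 'cV[k]_n) :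
  linfun (mulmx A) x = A *m x.
Proof. by rewrite lfunE. Qed.

Lemma memv_ker_mulmx (A : 'M[k]_n) (x : 'cV[k]_n) :
  (x \in lker (linfun (mulmx A))) = (A *m x == 0).
Proof. by rewrite memv_ker linfun_mulmxE. Qed.

Lemma ker_mulmx_full (A : 'M[k]_n) :
  lker (linfun (mulmx A) : 'Hom('cV[k]_n, 'cV[k]_n)) = fullv -> A = 0.
Proof.
move=> full; apply/matrixP => i j.
have : delta_mx j 0 \in lker (linfun (mulmx A) : 'Hom('cV[k]_n, 'cV[k]_n)).
  by rewrite full memvf.
rewrite memv_ker_mulmx -colE => /eqP/matrixP/(_ i 0).
by rewrite !mxE.
Qed.

Lemma ker_mulmx_unit (A : 'M[k]_n) : A \in unitmx ->
  lker (linfun (mulmx A) : 'Hom('cV[k]_n, 'cV[k]_n)) = 0%VS.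
Proof.
move=> uA; apply/eqP; rewrite -subv0; apply/subvP => x.
rewrite memv_ker_mulmx memv0 => /eqP Ax0.
by rewrite -(mulKmx uA x) Ax0 mulmx0.
Qed.

End ColumnVectors.

Lemma closed_eigenvector (k : closedFieldType) n (A : 'M[k]_n) : n != 0%N ->
  exists t, exists2 x : 'cV[k]_n, x != 0 & A *m x = t *: x.
Proof.
move=> n0.
(* [eigenvalue] is about row vectors, hence the transpose. The characteristic polynomial has size
   [n.+1], which differs from 1 because [n] is nonzero, so it has a root. *)
have [t] : exists t, root (char_poly A^T) t.
  by apply/closed_rootP; rewrite size_char_poly eqSS.
rewrite -eigenvalue_root_char => /eigenvalueP [x xA x0].
exists t, x^T; first by rewrite trmx_eq0.
by rewrite -[A]trmxK -trmx_mul xA linearZ.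
Qed.

(** * Stability along orbits and stabilisers of stable points *)

Section Stability.
Context (Q : quiver) (d : vertex Q -> nat) (theta : vertex Q -> int).

Lemma gl_rep_mul (k : fieldType) (g : GL k d) (M : rep k d) a :
  gl_rep g M a *m g (qtail a) = g (qhead a) *m M a.
Proof. by rewrite ffunE mulmxKV ?Defs.GL_unitmx. Qed.

(** Translation by $g^{-1}$ carries subrepresentations of $gM$ to subrepresentations of $M$ with the
    same dimension vector. *)
Lemma gl_rep_stable (k : fieldType) (g : GL k d) (M : rep k d) :
  stable theta M -> stable theta (gl_rep g M).
Proof.
move=> [d0 stM]; split=> // W subW [v Wv] [w Ww].
pose f u : 'End('cV[k]_(d u)) := linfun (mulmx (g^-1%g u)).
pose W' u := (f u @: W u)%VS.
have dimW' u : \dim (W' u) = \dim (W u).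
  by apply: limg_dim_eq; rewrite ker_mulmx_unit ?Defs.GL_unitmx ?capv0.
have -> : (fun u => \dim (W u)) = (fun u => \dim (W' u)).
  by apply/funext => u; rewrite dimW'.
apply: stM.
- move=> a _ /memv_imgP [x xW ->]; rewrite linfun_mulmxE.
  have := subW a x xW; rewrite ffunE => gMx.
  have := memv_img (f (qhead a)) gMx.
  by rewrite linfun_mulmxE !ffunE -!mulmxA mulKmx ?Defs.GL_unitmx.
- by exists v; rewrite -dimv_eq0 dimW' dimv_eq0.
- exists w; apply: contra Ww; rewrite -!dimv_leqif_eq ?subvf //.
  by rewrite dimW'.
Qed.

Lemma Delta_gl_rep (k : fieldType) (g : GL k d) (M : rep k d) :
  Delta k d g -> gl_rep g M = M.
Proof.
case=> t _ gt; apply/ffunP => a.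
apply: (can_inj (mulmxK (Defs.GL_unitmx g (qtail a)))).
by rewrite gl_rep_mul !gt scalar_mxC.
Qed.

Lemma Delta1 (k : fieldType) : Delta k d 1%g.
Proof. by exists 1; [exact: oner_neq0 | move=> v; rewrite ffunE]. Qed.

Lemma DeltaV (k : fieldType) (g : GL k d) : Delta k d g -> Delta k d g^-1%g.
Proof.
case=> t t0 gt; exists t^-1; first by rewrite invr_eq0.
by move=> v; rewrite ffunE gt invmx_scalar.
Qed.

Lemma stable_stabiliser (k : closedFieldType) (g : GL k d) (M : rep k d) :
  stable theta M -> gl_rep g M = M -> Delta k d g.
Proof.
move=> [[v dv] stM] gM.
have [t [x x0 gx]] := closed_eigenvector (g v) dv.
exists t.
  apply: contra_neq x0 => t0.
  by rewrite -(mulKmx (Defs.GL_unitmx g v) x) gx t0 scale0r mulmx0.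
pose A u := g u - t%:M.
(* $A = g - t$ is an endomorphism of $M$, so its kernel and image are subrepresentations. *)
have MA a : M a *m A (qtail a) = A (qhead a) *m M a.
  by rewrite mulmxBr mulmxBl -{1}gM gl_rep_mul scalar_mxC.
pose f u : 'End('cV[k]_(d u)) := linfun (mulmx (A u)).
suff kerf u : lker (f u) = fullv.
  by move=> u; apply/subr0_eq/ker_mulmx_full/kerf.
have dim_ker_img w : (\dim (lker (f w)) + \dim (limg (f w)) = d w)%N.
  by have := limg_ker_dim (f w) fullv; rewrite capfv dim_colv.
have kerv : lker (f v) != 0%VS.
  apply: contra_neq x0 => ker0; apply/eqP; rewrite -memv0 -ker0 memv_ker_mulmx.
  by rewrite mulmxBl gx mul_scalar_mx subrr.
(* The vertices [v] and [u] serve both subrepresentations: at [v] the kernel is nonzero and so the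
   image is not full, at [u] the kernel is not full and so the image is nonzero. *)
apply/eqP; apply: contraT => kerNfull.
have imgu : limg (f u) != 0%VS.
  rewrite -dimv_eq0; apply: contra kerNfull => /eqP img0.
  by rewrite -dimv_leqif_eq ?subvf // dim_colv -[X in _ == X]dim_ker_img img0 addn0.
have imgNfull : limg (f v) != fullv.
  rewrite -dimv_leqif_eq ?subvf // dim_colv -[X in _ == X]dim_ker_img.
  by rewrite -[X in X == _]add0n eqn_add2r eq_sym dimv_eq0.
exfalso; apply: (slope_seesaw dim_ker_img).
- by exists v; rewrite dimv_eq0.
- by exists u; rewrite dimv_eq0.
- apply: stM; [|by exists v|by exists u].
  move=> a y; rewrite !memv_ker_mulmx mulmxA -MA -mulmxA => /eqP ->.
  by rewrite mulmx0.
- apply: stM; [|by exists u|by exists v].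
  move=> a _ /memv_imgP [y _ ->]; rewrite linfun_mulmxE mulmxA MA -mulmxA.
  by rewrite -linfun_mulmxE memv_img ?memvf.
Qed.

End Stability.

(** * Coboundaries and trivial classes *)

Section Cohomology.
Context (S : finGroupType) (G : groupType) (act : S -> G -> G).
Context (actM : forall s, {morph act s : g h / (g * h)%g}).

Lemma group_act1 s : act s 1%g = 1%g.
Proof. by apply: (mulgI (act s 1%g)); rewrite -actM !mulg1. Qed.

Lemma group_actV s g : act s g^-1%g = (act s g)^-1%g.
Proof.
by apply: (mulgI (act s g)); rewrite -actM !mulgV group_act1.
Qed.

(** If $b(s) = g\,s(g)^{-1}$, right multiplication by $g$ or $g^{-1}$ turns witnesses relative to
    $b$ into witnesses relative to the trivial cocycle, and back. *)
Lemma H1_class_trivial (b : S -> G) : cohomologous act setT (fun=> 1%g) b ->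
  H1_class act setT b = H1_base act setT.
Proof.
move=> [g _ bE]; apply/seteqP; split=> b' [Zb' [h _ b'E]]; split=> //.
  by exists (h * g)%g => // s; rewrite b'E bE actM invMg !mulg1 !mulgA.
exists (h * g^-1)%g => // s; rewrite b'E bE actM group_actV invMg invgK.
by rewrite !mulg1 !mulgA mulgKV mulgKV.
Qed.

Lemma H1_class_refl (D : set G) b : D 1%g -> cocycle act D b ->
  H1_class act D b b.
Proof.
move=> D1 Zb; split=> //; exists 1%g => // s.
by rewrite group_act1 invg1 mulg1 mul1g.
Qed.

(** Since $g$ ranges over [G], this coboundary of [G] may have a nontrivial class in [H1 D]: this is
    how elements of the kernel are produced. The cocycle identity telescopes. *)
Lemma coboundary_cocycle (D : set G) (g : G) :
    (forall s1 s2 h, act (s1 * s2)%g h = act s1 (act s2 h)) ->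
    (forall s, D (g^-1 * act s g)%g) ->
  cocycle act D (fun s => g^-1 * act s g)%g.
Proof.
move=> act_comp Dg; split=> // s1 s2.
by rewrite act_comp actM group_actV !mulgA mulgK.
Qed.

End Cohomology.

(** * The fibre through an invariant stable point *)

Section Fibre.
Context (k : closedFieldType) (Q : quiver) (S : {group quiver_perm Q}).
Context (S_Aut : S \subset AutQ Q) (d : vertex Q -> nat).
Context (d_compat : compatible S d) (theta : vertex Q -> int).
Context (M0 : rep k d) (M0_fixed : rep_fixed S M0) (M0_stable : stable theta M0).

Let act (s : subg_of S) : GL k d -> GL k d := gl_act (sgval s).

Let actM s : {morph act s : g h / (g * h)%g}.
Proof. by move=> g h; apply: gl_act_mul (subgP s). Qed.

Let act_comp s1 s2 g : act (s1 * s2)%g g = act s1 (act s2 g).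
Proof. exact: gl_act_comp (subgP s1) (subgP s2). Qed.

Lemma gl_fixedP (g : GL k d) : gl_fixed S g <-> forall s, act s g = g.
Proof.
split=> [gS s|gS s sS]; first exact: gS (subgP s).
by have := gS (subg S s); rewrite /act subgK.
Qed.

Lemma rep_fixedP (N : rep k d) :
  rep_fixed S N <-> forall s : subg_of S, rep_act (sgval s) N = N.
Proof.
split=> [NS s|NS s sS]; first exact: NS (subgP s).
by have := NS (subg S s); rewrite subgK.
Qed.

Lemma gl_repK (g : GL k d) : cancel (gl_rep g) (gl_rep g^-1%g).
Proof. by move=> N; rewrite -gl_repM mulVg gl_rep1. Qed.

Lemma gl_fixed1 : gl_fixed S (1%g : GL k d).
Proof. by apply/gl_fixedP => s; apply: group_act1. Qed.

(** As $M_0$ is invariant, $s(gM_0) = s(g)M_0$; invariance of $gM_0$ thus means that $g^{-1}s(g)$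
    stabilises $M_0$. *)
Lemma rep_fixed_Delta (g : GL k d) : rep_fixed S (gl_rep g M0) <->
  forall s, Delta k d (g^-1 * act s g)%g.
Proof.
have sM s : rep_act (sgval s) (gl_rep g M0) = gl_rep (act s g) M0.
  have sS := subgP s.
  by rewrite (rep_act_gl S_Aut d_compat) // M0_fixed.
split=> [/rep_fixedP gS s|gS].
  apply: (stable_stabiliser M0_stable).
  by rewrite gl_repM -sM gS gl_repK.
apply/rep_fixedP => s; rewrite sM.
by rewrite -(mulKVg g (act s g)) gl_repM (Delta_gl_rep _ (gS s)).
Qed.

(** Collecting the cocycles of all $g$ with $gM_0$ in [O] avoids choosing a representative; on the
    fibre this set turns out to be one full cohomology class. *)
Definition fibre_cocycles (O : set (rep k d)) : set (subg_of S -> GL k d) :=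
  [set b | exists2 g, O (gl_rep g M0) &
             forall s, b s = (g^-1 * act s g)%g].

Lemma gl_orbit_fixed (N N' : rep k d) : rep_fixed S N ->
  gl_orbit (gl_fixed S) N N' -> rep_fixed S N'.
Proof.
move=> NS [h hS <-] s sS.
by rewrite (rep_act_gl S_Aut d_compat) // NS // hS.
Qed.

Lemma gl_orbit_eq (N N' : rep k d) : gl_orbit (gl_fixed S) N N' ->
  gl_orbit (gl_fixed S) N' = gl_orbit (gl_fixed S) N.
Proof.
move=> [h /gl_fixedP hS <-]; apply/seteqP; split=> _ [x /gl_fixedP xS <-].
  exists (x * h)%g; last by rewrite gl_repM.
  by apply/gl_fixedP => s; rewrite actM xS hS.
exists (x * h^-1)%g; last by rewrite gl_repM gl_repK.
by apply/gl_fixedP => s; rewrite actM group_actV // xS hS.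
Qed.

(** The admissible elements are $hgt^{-1}$ with $h$ invariant and $t$ in [Delta]. In the cocycle $h$
    cancels, while $t$ gives exactly the change by a coboundary of [Delta]. *)
Lemma fibre_cocyclesE (g : GL k d) : rep_fixed S (gl_rep g M0) ->
  fibre_cocycles (gl_orbit (gl_fixed S) (gl_rep g M0)) =
  H1_class act (Delta k d) (fun s => g^-1 * act s g)%g.
Proof.
move=> gS; apply/seteqP; split=> b.
  move=> [x xO bE]; have xS := gl_orbit_fixed gS xO.
  have -> : b = (fun s => x^-1 * act s x)%g by apply/funext.
  split; first by apply: coboundary_cocycle => //; apply/rep_fixed_Delta.
  have [h /gl_fixedP hS hE] := xO.
  (* Both $x$ and $hg$ send $M_0$ to the same point, so this quotient stabilises $M_0$. *)
  exists (x^-1 * (h * g))%g.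
    apply: (stable_stabiliser M0_stable).
    by rewrite gl_repM [gl_rep (h * g)%g _]gl_repM hE gl_repK.
  move=> s; rewrite !actM group_actV // hS !invMg invgK !mulgA.
  by rewrite !(mulgK, mulgKV).
move=> [Zb [t Dt bE]].
exists (g * t^-1)%g.
  rewrite gl_repM [gl_rep t^-1%g _]Delta_gl_rep; last exact: DeltaV.
  by exists 1%g; [exact: gl_fixed1 | rewrite gl_rep1].
by move=> s; rewrite bE actM group_actV // invMg invgK !mulgA.
Qed.

Lemma fibreP (O : set (rep k d)) :
  f_rs_fibre S theta (gl_orbit setT M0) O <->
  exists2 g, rep_fixed S (gl_rep g M0) &
             O = gl_orbit (gl_fixed S) (gl_rep g M0).
Proof.
split=> [[[N [NS Nst] <-]]|[g gS ->]].
  rewrite f_rs_orbit; last exact: gl_fixed1.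
  move=> NM; have [g _ gE] : gl_orbit setT M0 N.
    by rewrite -NM; exists 1%g => //; rewrite gl_rep1.
  by exists g; rewrite gE.
split; first by exists (gl_rep g M0) => //; split=> //; apply: gl_rep_stable.
rewrite f_rs_orbit; last exact: gl_fixed1.
apply/seteqP; split=> _ [h _ <-].
  by exists (h * g)%g; rewrite // gl_repM.
by exists (h * g^-1)%g; rewrite // gl_repM gl_repK.
Qed.

Lemma fibre_cocycles_bij :
  set_bij (f_rs_fibre S theta (gl_orbit setT M0)) (ker_H1_Delta k d S)
    fibre_cocycles.
Proof.
split.
- move=> _ /fibreP [g gS ->]; rewrite fibre_cocyclesE //.
  have Zg : cocycle act (Delta k d) (fun s => g^-1 * act s g)%g.
    by apply: coboundary_cocycle => //; apply/rep_fixed_Delta.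
  (* Every member of the [Delta]-class is a coboundary in the whole group, with witness
     $tg^{-1}$. *)
  have base b : H1_class act (Delta k d) (fun s => g^-1 * act s g)%g b ->
      H1_class act setT b = H1_base act setT.
    move=> [_ [t _ bE]]; apply: H1_class_trivial => //.
    exists (t * g^-1)%g => // s; rewrite bE actM group_actV // invMg invgK.
    by rewrite mulg1 !mulgA.
  split; first by exists (fun s => g^-1 * act s g)%g.
  apply/seteqP; split=> b; first by move=> [b' /base <-].
  move=> Bb; exists (fun s => g^-1 * act s g)%g.
    by apply: H1_class_refl => //; apply: Delta1.
  by rewrite base //; apply: H1_class_refl => //; apply: Delta1.
- move=> O1 O2 /set_mem /fibreP [g gS ->] /set_mem /fibreP [h hS ->] e.
  (* Injectivity: the cocycle of $g$ also comes from some $x$ with $xM_0$ in the second orbit. Then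
     $g^{-1}s(g) = x^{-1}s(x)$ makes $xg^{-1}$ invariant, and it maps $gM_0$ to $xM_0$. *)
  have [x xO2 xE] : fibre_cocycles (gl_orbit (gl_fixed S) (gl_rep h M0))
      (fun s => g^-1 * act s g)%g.
    rewrite -e; exists g => //.
    by exists 1%g; [exact: gl_fixed1 | rewrite gl_rep1].
  rewrite -(gl_orbit_eq xO2); apply/esym/gl_orbit_eq.
  exists (x * g^-1)%g; last by rewrite gl_repM gl_repK.
  apply/gl_fixedP => s; rewrite actM group_actV //.
  have /(congr1 (mulg x)) := xE s; rewrite mulKVg => <-.
  by rewrite !mulgA mulgK.
- move=> c [[b Zb <-] kerb].
  (* Surjectivity: triviality in the whole group gives $b(s) = g\,s(g)^{-1}$, the cocycle attached
     to $g^{-1}$. *)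
  have [_ [g _ bE]] : H1_base act setT b.
    rewrite -kerb; exists b; first by apply: H1_class_refl => //; apply: Delta1.
    by apply: H1_class_refl => //; split=> //; case: Zb.
  have bE' : b = (fun s => g^-1^-1 * act s g^-1)%g.
    by apply/funext => s; rewrite bE group_actV // mulg1 invgK.
  have gS : rep_fixed S (gl_rep g^-1%g M0).
    by apply/rep_fixed_Delta => s; case: Zb => + _ => /(_ s); rewrite bE'.
  exists (gl_orbit (gl_fixed S) (gl_rep g^-1%g M0)).
    by apply/fibreP; exists g^-1%g.
  by rewrite fibre_cocyclesE // -bE'.
Qed.

End Fibre.

Theorem proposition3p11 (k : closedFieldType) (Q : quiver)
    (S : {group quiver_perm Q}) (S_Aut : S \subset AutQ Q)
    (d : vertex Q -> nat) (d_compat : compatible S d)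
    (theta : vertex Q -> int) (theta_compat : compatible S theta)
    (M : rep k d) (M_stable : stable theta M) :
  f_rs_fibre S theta (gl_orbit setT M) !=set0 ->
  exists phi : set (rep k d) -> set (subg_of S -> GL k d),
    set_bij (f_rs_fibre S theta (gl_orbit setT M)) (ker_H1_Delta k d S) phi.
Proof.
(* $M$ itself may fail to be invariant; a point of the fibre supplies an invariant stable $M_0$ in
   its orbit, which becomes the base point. *)
move=> [_ [[M0 [M0S M0st] <-]]].
rewrite f_rs_orbit; last exact: gl_fixed1.
move=> <-; exists (@fibre_cocycles k Q S d M0).
exact: fibre_cocycles_bij.
Qed.
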